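(* Let $n\ge1$, let $\Omega:\mathbb{R}^n\setminus\{0\}\to\mathbb{R}$ be homogeneous of degree zero, with restriction to $S^{n-1}$ Lipschitz, with $\int_{S^{n-1}}\Omega=0$, and such that the set $\{\Omega=0\}$ has measure zero. Let $$Tf(x)=\mathrm{p.v.}\int_{\mathbb{R}^n}\frac{\Omega(x-y)}{|x-y|^n}f(y)\,dy,\qquad T^*f(x)=\mathrm{p.v.}\int_{\mathbb{R}^n}\frac{\Omega(y-x)}{|x-y|^n}f(y)\,dy .$$ There is a constant $C(\Omega,n)$, depending only on $\Omega$ and $n$, such that the following holds. Let $b$ be a real-valued locally integrable function on $\mathbb{R}^n$. Suppose there exists a constant $B$ such that for every measurable set $E\subset\mathbb{R}^n$ and every $t>0$, $$|\{x\in\mathbb{R}^n:\ |[b,T]\chi_E(x)|>t\}|\le\int_{\mathbb{R}^n}\phi_1\left(\frac{B\chi_E(x)}{t}\right)dx$$ and $$|\{x\in\mathbb{R}^n:\ |[b,T^*]\chi_E(x)|>t\}|\le\int_{\mathbb{R}^n}\phi_1\left(\frac{B\chi_E(x)}{t}\right)dx .$$ Then $b\in\mathrm{BMO}(\mathbb{R}^n)$ and $\|b\|_{\mathrm{BMO}(\mathbb{R}^n)}\le C(\Omega,n)\,B$.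
   Context: $|\cdot|$ of a set is Lebesgue measure, $\log^+t=\max(\log t,0)$, $\phi_1(t)=t(1+\log^+t)$ for $t>0$ and $\phi_1(0)=0$. $\chi_E$ is the indicator function of $E$. For $S\in\{T,T^*\}$ the commutator is $[b,S]f=S(bf)-bS(f)$, with principal values understood as limits as $\varepsilon\to0$ of integrals over $|x-y|>\varepsilon$. The operator $T^*$ is the adjoint of $T$. The hypotheses are imposed for those measurable $E$ for which the commutator applied to $\chi_E$ is defined a.e.; this includes every bounded measurable $E$. $\mathrm{BMO}(\mathbb{R}^n)$ is the set of $b\in L^1_{\mathrm{loc}}(\mathbb{R}^n)$ with $\|b\|_{\mathrm{BMO}(\mathbb{R}^n)}=\sup_Q\frac1{|Q|}\int_Q|b(x)-b_Q|\,dx<\infty$, the supremum being over cubes $Q$ with edges parallel to the axes, with $b_Q=\frac1{|Q|}\int_Qb$. *)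

(* Defs.v *)
From HB Require Import structures.
From mathcomp Require Import all_boot all_order all_algebra.
From mathcomp Require Import all_classical all_reals all_analysis.
From mathcomp Require Import measurable_realfun.

Set Implicit Arguments.
Unset Strict Implicit.
Unset Printing Implicit Defensive.
Import Order.TTheory GRing.Theory Num.Theory.
Import numFieldNormedType.Exports.
Local Open Scope classical_set_scope.
Local Open Scope ring_scope.

Definition row_display : measure_display.
Proof. exact: default_measure_display. Qed.

Section borel_row.
Context (R : realType) (n : nat).

Definition row_coor (i : 'I_n) (v : 'rV[R]_n) : measurableTypeR R := v 0 i.

Let row_set0 : g_sigma_preimage row_coor set0.
Proof. exact: sigma_algebra0. Qed.

Let row_setC A : g_sigma_preimage row_coor A -> g_sigma_preimage row_coor (~` A).
Proof. exact: sigma_algebraC. Qed.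

Let row_bigcup (F : _^nat) : (forall i, g_sigma_preimage row_coor (F i)) ->
  g_sigma_preimage row_coor (\bigcup_i (F i)).
Proof. exact: sigma_algebra_bigcup. Qed.

HB.instance Definition _ :=
  @isMeasurable.Build row_display
  'rV[R]_n (g_sigma_preimage row_coor) row_set0 row_setC row_bigcup.

End borel_row.

Lemma measurable_row_coor (R : realType) n (i : 'I_n) :
  measurable_fun setT (@row_coor R n i).
Proof.
move=> _ Y mY; rewrite setTI; apply: sub_sigma_algebra => /=.
rewrite -bigcup_seq/=; exists i => /=; first by rewrite mem_index_enum.
by exists Y => //; rewrite setTI.
Qed.

Lemma measurable_fun_rowP (R : realType) d (T : measurableType d) n
    (f : T -> 'rV[R]_n) :
  measurable_fun setT f <->
  forall i, measurable_fun setT (fun x => f x 0 i).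
Proof.
split=> [mf i|mf].
  by apply: (measurableT_comp (@measurable_row_coor R n i) mf).
suff H : @g_sigma_preimage _ (measurableTypeR R) 'rV[R]_n n (@row_coor R n)
    `<=` (fun A => measurable (f @^-1` A)).
  by move=> _ A mA; rewrite setTI; exact: H.
apply: smallest_sub.
  split => /=.
  - by rewrite preimage_set0; exact: measurable0.
  - by move=> A mA; rewrite setTD preimage_setC; exact: measurableC.
  - by move=> F mF; rewrite preimage_bigcup; exact: bigcup_measurable.
rewrite -bigcup_seq; apply: bigcup_sub => i _ A [B mB <-] /=.
by rewrite setTI; have := mf i measurableT B mB; rewrite setTI.
Qed.

Lemma product_sigma_finite d1 d2 (T1 : measurableType d1)
    (T2 : measurableType d2) (R : realType)
    (m1 : {sigma_finite_measure set T1 -> \bar R})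
    (m2 : {sigma_finite_measure set T2 -> \bar R}) :
  sigma_finite setT (m1 \x m2)%E.
Proof.
have /sigma_finiteP[F [TF ndF Foo]] := sigma_finiteT m1.
have /sigma_finiteP[G [TG ndG Goo]] := sigma_finiteT m2.
exists (fun k => F k `*` G k).
  rewrite -setXTT TF TG predeqE => -[x y]; split.
    move=> [/= [i _ Fix] [k _ Gky]]; exists (maxn i k) => //; split.
    - by move: x Fix; exact/subsetPset/ndF/leq_maxl.
    - by move: y Gky; exact/subsetPset/ndG/leq_maxr.
  by move=> [i _ []/= ? ?]; split; exists i.
move=> k; have [? ?] := Foo k; have [? ?] := Goo k.
split; first exact: measurableX.
by rewrite product_measure1E// lte_mul_pinfty// ge0_fin_numE.
Qed.

Lemma pushforward_sigma_additive d1 d2 (T1 : measurableType d1)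
    (T2 : measurableType d2) (R : realType) (mu : {measure set T1 -> \bar R})
    (f : T1 -> T2) : measurable_fun setT f ->
  semi_sigma_additive (pushforward mu f).
Proof.
move=> mf F mF tF mUF.
have mV A : measurable A -> measurable (f @^-1` A).
  by move=> mA; rewrite -[X in measurable X]setTI; exact: mf.
rewrite /pushforward preimage_bigcup; apply: measure_semi_sigma_additive.
- by move=> k; exact: mV.
- apply/trivIsetP => i j _ _ ij; rewrite -preimage_setI.
  by move/trivIsetP : tF => ->//; rewrite preimage_set0.
- by rewrite -preimage_bigcup; exact: mV.
Qed.

Section cons_row.
Context (R : realType) (n : nat).

Definition cons_row (p : measurableTypeR R * 'rV[R]_n) : 'rV[R]_n.+1 :=
  \row_i oapp (fun j => p.2 0 j) p.1 (unlift ord0 i).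

Lemma measurable_cons_row : measurable_fun setT cons_row.
Proof.
apply/measurable_fun_rowP => i.
under eq_fun do rewrite mxE.
case: unliftP => [j _|_] /=; last exact: measurable_fst.
exact: (measurableT_comp (@measurable_row_coor R n j) measurable_snd).
Qed.

HB.instance Definition _ :=
  isMeasurableFun.Build _ _ _ _ cons_row measurable_cons_row.

Definition uncons_row (v : 'rV[R]_n.+1) : measurableTypeR R * 'rV[R]_n :=
  (v 0 ord0, \row_j v 0 (lift ord0 j)).

Lemma cons_rowK : cancel cons_row uncons_row.
Proof.
move=> [a v]; rewrite /uncons_row /cons_row mxE unlift_none /=; congr pair.
by apply/rowP => j; rewrite !mxE liftK.
Qed.

Lemma measurable_uncons_row : measurable_fun setT uncons_row.
Proof.
apply/measurable_fun_pairP; split; first exact: measurable_row_coor.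
apply/measurable_fun_rowP => i /=.
under eq_fun do rewrite mxE.
exact: measurable_row_coor.
Qed.

Variable mu : {sigma_finite_measure set 'rV[R]_n -> \bar R}.

Definition lebesgue_cons : set 'rV[R]_n.+1 -> \bar R :=
  pushforward (@lebesgue_measure R \x mu)%E cons_row.

Let lebesgue_cons0 : lebesgue_cons set0 = 0%E.
Proof. by rewrite /lebesgue_cons /pushforward preimage_set0 measure0. Qed.

Let lebesgue_cons_ge0 A : (0 <= lebesgue_cons A)%E.
Proof. exact: measure_ge0. Qed.

HB.instance Definition _ := isMeasure.Build _ _ _ lebesgue_cons
  lebesgue_cons0 lebesgue_cons_ge0
  (pushforward_sigma_additive measurable_cons_row).

Let lebesgue_cons_sigma_finite : sigma_finite setT lebesgue_cons.
Proof.
have [F FT mF] := product_sigma_finite lebesgue_measure mu.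
exists (fun k => uncons_row @^-1` F k).
  by rewrite -preimage_bigcup -FT preimage_setT.
move=> k; have [mFk Fk] := mF k; split.
  by rewrite -[X in measurable X]setTI; exact: measurable_uncons_row.
rewrite /lebesgue_cons /pushforward -comp_preimage.
by rewrite (_ : _ \o _ = id)//; apply/funext => p /=; rewrite cons_rowK.
Qed.

HB.instance Definition _ :=
  Measure_isSigmaFinite.Build _ _ _ lebesgue_cons lebesgue_cons_sigma_finite.

End cons_row.

(* The [n]-fold product of [lebesgue_measure], on Borel sets. *)
Fixpoint borel_lebesgue (R : realType) (n : nat) :
    {sigma_finite_measure set 'rV[R]_n -> \bar R} :=
  match n with
  | 0 => @dirac _ 'rV[R]_0 0 R
  | m.+1 => lebesgue_cons (borel_lebesgue R m)
  end.

Section euclidean.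
Context (R : realType) (n : nat).
Implicit Types (x y : 'rV[R]_n) (A : set 'rV[R]_n).

(* The norm `|x| of 'rV[R]_n is the maximum norm. *)
Definition enorm x : R := Num.sqrt (\sum_i x 0 i ^+ 2).

Definition esphere : set 'rV[R]_n := [set x | enorm x = 1].

(* Completion of [borel_lebesgue]; its measurable sets are the Caratheodory
   sets, i.e. the Lebesgue measurable ones. *)
Definition lebesgue := @completed_measure_extension _ _ _ (borel_lebesgue R n).

HB.instance Definition _ := Measure.on lebesgue.

Definition punctured_ball : set 'rV[R]_n := [set x | 0 < enorm x < 1].

Definition normalize x : 'rV[R]_n := (enorm x)^-1 *: x.

Lemma measurable_enorm : measurable_fun setT enorm.
Proof.
apply: measurableT_comp.
  by apply: nondecreasing_measurable => // a b; exact: ler_wsqrtr.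
apply: measurable_sum => i; apply: measurable_funX.
exact: measurable_row_coor.
Qed.

Lemma measurable_punctured_ball : measurable punctured_ball.
Proof.
rewrite (_ : punctured_ball = setT `&` enorm @^-1` `]0, 1[%classic).
  exact: measurable_enorm.
by rewrite setTI; apply/seteqP; split=> x; rewrite /= in_itv.
Qed.

Lemma measurable_normalize : measurable_fun setT normalize.
Proof.
apply/measurable_fun_rowP => i.
under eq_fun do rewrite mxE.
apply: measurable_funM; last exact: measurable_row_coor.
under eq_fun do rewrite -powR_inv1 ?sqrtr_ge0//.
exact: measurableT_comp (measurable_powR _) measurable_enorm.
Qed.

(* Surface measure of [A `&` esphere]: [n] times the volume of the part of the
   unit ball that projects radially into [A]. *)
Definition surface_measure A : \bar R :=
  (n%:R%:E * borel_lebesgue R n (normalize @^-1` A `&` punctured_ball))%E.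

Let surface_measure0 : surface_measure set0 = 0%E.
Proof. by rewrite /surface_measure preimage_set0 set0I measure0 mule0. Qed.

Let surface_measure_ge0 A : (0 <= surface_measure A)%E.
Proof. by rewrite mule_ge0. Qed.

Let surface_measure_sigma_additive : semi_sigma_additive surface_measure.
Proof.
exact: (@pushforward_sigma_additive _ _ _ _ _
  (mscale n%:R%:nng (mrestr (borel_lebesgue R n) measurable_punctured_ball))
  _ measurable_normalize).
Qed.

HB.instance Definition _ := isMeasure.Build _ _ _ surface_measure
  surface_measure0 surface_measure_ge0 surface_measure_sigma_additive.

End euclidean.
Arguments lebesgue {R n}.
Arguments surface_measure {R n}.

(* 'rV[R]_n with the sigma-algebra of Lebesgue measurable sets; the canonical
   sigma-algebra on 'rV[R]_n itself is the Borel one. *)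
Notation lebesgue_space R n :=
  (caratheodory_type (@mu_ext _ 'rV[R]_n R (borel_lebesgue R n))).

Section singular_integral.
Context (R : realType) (n : nat).
Implicit Types (Omega b f : 'rV[R]_n -> R) (k : 'rV[R]_n -> 'rV[R]_n -> R).

(* The value of [Omega] at 0 plays no role. *)
Definition homogeneous0 Omega := forall (r : R) (x : 'rV[R]_n),
  0 < r -> x != 0 -> Omega (r *: x) = Omega x.

Definition sphere_lipschitz Omega := exists L : R, forall x y : 'rV[R]_n,
  esphere x -> esphere y -> `|Omega x - Omega y| <= L * enorm (x - y).

Definition czk Omega (x y : 'rV[R]_n) : R :=
  Omega (x - y) / enorm (x - y) ^+ n.

Definition czk_adj Omega (x y : 'rV[R]_n) : R :=
  Omega (y - x) / enorm (x - y) ^+ n.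

Definition off_ball (x : 'rV[R]_n) (e : R) : set (lebesgue_space R n) :=
  [set y | e < enorm (x - y)].

Definition truncated k f (x : 'rV[R]_n) (e : R) : R :=
  \int[lebesgue]_(y in off_ball x e) (k x y * f y).

Definition pv k f (x : 'rV[R]_n) : R := lim (truncated k f x e @[e --> 0^'+]).

Definition pv_defined k f (x : 'rV[R]_n) : Prop :=
  (forall e : R, 0 < e ->
    lebesgue.-integrable (off_ball x e) (fun y => (k x y * f y)%:E)) /\
  cvg (truncated k f x e @[e --> 0^'+]).

Definition commutator b k f (x : 'rV[R]_n) : R :=
  pv k (b \* f) x - b x * pv k f x.

Definition commutator_defined b k f (x : 'rV[R]_n) : Prop :=
  pv_defined k (b \* f) x /\ pv_defined k f x.

(* [ln 0 = 0], so [phi1 0 = 0]. *)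
Definition phi1 (t : R) : R := t * (1 + Num.max (ln t) 0).

(* Bounded measurable sets are always test sets: for the kernels considered
   here the commutator of a bounded set is defined a.e., by the existence of
   principal values of integrable functions. *)
Definition test_set b k (E : set (lebesgue_space R n)) : Prop :=
  measurable E /\
  (bounded_set (E : set 'rV[R]_n) \/
   {ae lebesgue, forall x, commutator_defined b k \1_E x}).

Definition weak_estimate b k (B : R) : Prop :=
  forall E : set (lebesgue_space R n), test_set b k E ->
  forall t : R, 0 < t ->
  (lebesgue [set x | commutator_defined b k \1_E x /\
                     (t < `|commutator b k \1_E x|)%R ] <=
   \int[lebesgue]_x (phi1 (B * \1_E x / t)%R)%:E)%E.

Definition loc_integrable b : Prop :=
  measurable_fun (setT : set (lebesgue_space R n)) b /\
  forall K : set 'rV[R]_n, compact K ->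
    (\int[lebesgue]_(x in K) `|b x|%:E < +oo)%E.

Definition cube (a : 'rV[R]_n) (l : R) : set (lebesgue_space R n) :=
  [set x : 'rV[R]_n | forall i, a 0 i <= x 0 i <= a 0 i + l].

Definition mean b (Q : set (lebesgue_space R n)) : R :=
  (fine (lebesgue Q))^-1 * \int[lebesgue]_(x in Q) b x.

Definition mean_osc b (Q : set (lebesgue_space R n)) : \bar R :=
  ((fine (lebesgue Q))^-1%R%:E *
   \int[lebesgue]_(x in Q) `|(b x - mean b Q)%R|%:E)%E.

Definition bmo_norm b : \bar R :=
  ereal_sup [set z | exists (a : 'rV[R]_n) (l : R),
    0 < l /\ z = mean_osc b (cube a l)].

Definition BMO b : Prop := loc_integrable b /\ (bmo_norm b < +oo)%E.

End singular_integral.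

(* Main.v *)
(* Let Q be a cube of side l and let u be a point where Omega does not vanish.
   For a large constant N, the translate P of Q by l N u is such that the kernel
   has constant sign and size at least c / l^n on P x Q.  Let m be a median of
   b on P.  If E is the part of Q where b <= m and F the part of P where
   m <= b, then on F there is no cancellation in [b,T] 1_E, so that
     |[b,T] 1_E| >= (c / l^n) * (integral of |b - m| over E)  on F.
   As |F| >= |Q| / 2, the weak type estimate at any smaller level t gives
   phi1 (B / t) >= 1 / 2, that is t <= 2 B.  The same argument with the two
   inequalities reversed bounds the integral of |b - m| over the rest of Q. *)
Require Import Defs.
From mathcomp Require Import all_boot all_order all_algebra.
From mathcomp Require Import all_classical all_reals all_analysis.
From mathcomp Require Import measurable_realfun lra ring.
Import Order.TTheory GRing.Theory Num.Theory.
Import numFieldNormedType.Exports.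
Local Open Scope classical_set_scope.
Local Open Scope ring_scope.
Set Implicit Arguments.
Unset Strict Implicit.
Unset Printing Implicit Defensive.

(** * Borel and Lebesgue measurability; the volume of cubes *)

Lemma measurable_open_row (R : realType) (n : nat) (U : set 'rV[R]_n) :
  open U -> measurable U.
Proof.
move=> oU.
(* The sigma-algebra is generated by the coordinates, so an open set has to be exhausted by
   countably many coordinate boxes: rational centre, radius 1/(k+1). [F] discards the boxes that do
   not fit in [U]. *)
pose box (p : 'rV[rat]_n * nat) : set 'rV[R]_n :=
  \bigcap_(i in [set: 'I_n])
    (row_coor i @^-1` ball (ratr (p.1 0 i) : R) p.2.+1%:R^-1).
pose F p := if `[< box p `<=` U >] then box p else set0.
have -> : U = \bigcup_p F p.
  apply/seteqP; split=> [x Ux|x [p _]]; last first.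
    by rewrite /F; case: asboolP => // /[apply].
  have /nbhs_ballP[e /= e0 xeU] : nbhs x U by exact: open_nbhs_nbhs.
  (* Half of [e], because [x] and any other point of the box are each within 1/(k+1) of the
     centre. *)
  have [k ke] : exists k : nat, k.+1%:R^-1 < e / 2 :> R.
    have [N _ /(_ N (leqnn N))] :=
      near_infty_natSinv_lt (PosNum (divr_gt0 e0 (ltr0Sn R 1))).
    by exists N.
  have k0 : 0 < k.+1%:R^-1 :> R by rewrite invr_gt0.
  have /boolp.choice[q qx] : forall i : 'I_n,
      exists q : rat, ball (x 0 i) k.+1%:R^-1 (ratr q).
    move=> i.
    have [|q] := @rat_in_itvoo R (x 0 i - k.+1%:R^-1) (x 0 i + k.+1%:R^-1).
      by rewrite ltrBlDr -addrA ltrDl addr_gt0.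
    by rewrite in_itv /= => qx; exists q; rewrite /ball /= ltr_distlC.
  have bx : box (\row_i q i, k) x.
    by move=> i _; rewrite /= mxE; exact/ball_sym/qx.
  exists (\row_i q i, k) => //; rewrite /F asboolT // => y yb.
  apply: xeU; split => // i j; rewrite ord1.
  have yj : ball (ratr (q j) : R) k.+1%:R^-1 (y 0 j).
    by have := yb j Logic.I; rewrite /= mxE.
  apply: le_ball (ball_triangle (qx j) yj).
  by rewrite [leRHS]splitr lerD // ltW.
apply: countable_bigcupT_measurable; first exact: countableP.
move=> p; rewrite /F; case: ifP => _; last exact: measurable0.
apply: fin_bigcap_measurable; first exact: finite_finset.
move=> i _; rewrite -[X in measurable X]setTI.
apply: measurable_row_coor => //; exact: measurable_ball.
Qed.

Lemma measurable_fun_open_row (R : realType) (n : nat) (U : set 'rV[R]_n)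
    (f : 'rV[R]_n -> R) :
  open U -> (forall x, U x -> {for x, continuous f}) -> measurable_fun U f.
Proof.
move=> oU cf; apply: (measurability _ (RGenOInfty.measurableE R)).
move=> _ [_ [a ->] <-]; apply: measurable_open_row.
rewrite openE => x [Ux fx]; rewrite /interior.
apply: filterI; first exact: open_nbhs_nbhs.
by apply: (cf x Ux); apply: open_nbhs_nbhs; split => //; exact: itv_open.
Qed.

Lemma measurable_lebesgue_space (R : realType) (n : nat) (A : set 'rV[R]_n) :
  measurable A -> measurable (A : set (lebesgue_space R n)).
Proof. exact: caratheodory_measurable_mu_ext. Qed.

Lemma measurable_fun_lebesgue_space (R : realType) (n : nat)
    (D : set 'rV[R]_n) (f : 'rV[R]_n -> R) :
  measurable D -> measurable_fun D f ->
  measurable_fun (D : set (lebesgue_space R n)) f.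
Proof.
by move=> mD mf _ Y mY; apply: measurable_lebesgue_space; exact: mf.
Qed.

Lemma lebesgueE (R : realType) (n : nat) (A : set 'rV[R]_n) :
  measurable A ->
  lebesgue (A : set (lebesgue_space R n)) = borel_lebesgue R n A.
Proof. exact: measurable_mu_extE. Qed.

(** This is monotonicity of the outer measure, valid for arbitrary sets: the superlevel sets of the
    commutator, to which it is applied, are never shown to be measurable. *)
Lemma le_lebesgue (R : realType) (n : nat) (A B : set (lebesgue_space R n)) :
  A `<=` B -> (lebesgue A <= lebesgue B)%E.
Proof. exact: (@le_mu_ext _ _ _ (borel_lebesgue R n)). Qed.

Lemma cubeE (R : realType) (n : nat) (a : 'rV[R]_n) (l : R) :
  cube a l = [set x : 'rV[R]_n | forall i, `[a 0 i, a 0 i + l]%classic (x 0 i)].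
Proof. by apply/seteqP; split=> x /= + i => /(_ i); rewrite in_itv. Qed.

Lemma measurable_cube_row (R : realType) (n : nat) (a : 'rV[R]_n) (l : R) :
  measurable (cube a l : set 'rV[R]_n).
Proof.
have -> : (cube a l : set 'rV[R]_n) = \bigcap_(i in [set: 'I_n])
    (row_coor i @^-1` `[a 0 i, a 0 i + l]%classic).
  rewrite cubeE; apply/seteqP; split=> x /= h i; first by move=> _; exact: h.
  exact: (h i Logic.I).
apply: fin_bigcap_measurable; first exact: finite_finset.
move=> i _; rewrite -[X in measurable X]setTI.
exact: measurable_row_coor.
Qed.

Lemma measurable_cube (R : realType) (n : nat) (a : 'rV[R]_n) (l : R) :
  measurable (cube a l).
Proof. by apply: measurable_lebesgue_space; exact: measurable_cube_row. Qed.

Lemma compact_cube (R : realType) (n : nat) (a : 'rV[R]_n) (l : R) :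
  compact (cube a l : set 'rV[R]_n).
Proof.
rewrite cubeE.
apply: (@rV_compact _ _ (fun i => `[a 0 i, a 0 i + l]%classic)) => i.
exact: segment_compact.
Qed.

(** Induction on the dimension: through [cons_row] the cube is a segment times a cube of one
    dimension less, and in dimension 0 the measure is the Dirac mass at the only point. *)
Lemma lebesgue_cube (R : realType) (n : nat) (a : 'rV[R]_n) (l : R) :
  0 <= l -> lebesgue (cube a l) = (l ^+ n)%:E.
Proof.
move=> l0; rewrite lebesgueE; last exact: measurable_cube_row.
elim: n a => [|n IHn] a.
  rewrite expr0 [LHS]/= diracE mem_set //; by case.
rewrite /= /lebesgue_cons /pushforward.
pose a' : 'rV[R]_n := \row_j a 0 (lift ord0 j).
have -> : @cons_row R n @^-1` cube a l =
    (`[a 0 ord0, a 0 ord0 + l]%classic : set (measurableTypeR R)) `*` cube a' l.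
  apply/seteqP; split=> [[x v] /= h|[x v] /= [hx hv] i].
    split; first by have := h ord0; rewrite mxE unlift_none /= in_itv.
    by move=> i; have := h (lift ord0 i); rewrite mxE liftK /= mxE.
  rewrite mxE; case: unliftP => [j ->|->] /=; last by move: hx; rewrite in_itv.
  by have := hv j; rewrite mxE.
rewrite product_measure1E //; last exact: measurable_cube_row.
rewrite IHn; move: (a 0 ord0) => c.
(* The length of a segment is given by cases; for [l = 0] both sides vanish, since the exponent on
   the right is [n.+1]. *)
transitivity ((if (c < c + l)%R then (c + l)%:E - c%:E else 0) * (l ^+ n)%:E)%E.
  congr (_ * _)%E; apply: (eq_trans (lebesgue_measure_itv _)).
  by rewrite /= lte_fin.
  
rewrite ltrDl; case: ltP => [_|l0'].
  by rewrite -EFinB addrAC subrr add0r -EFinM exprS.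
by rewrite (_ : l = 0) ?exprS ?mul0r ?mul0e //; apply/le_anti/andP.
Qed.

(** * The Euclidean norm and the homogeneous kernel away from the diagonal *)

Section enorm.
Variables (R : realType) (n : nat).
Implicit Types (x v w : 'rV[R]_n) (Omega : 'rV[R]_n -> R).

Lemma enormZ (r : R) x : 0 <= r -> enorm (r *: x) = r * enorm x.
Proof.
move=> r0; rewrite /enorm; under eq_bigr do rewrite mxE exprMn.
by rewrite -mulr_sumr sqrtrM ?exprn_ge0 // sqrtr_sqr ger0_norm.
Qed.

Lemma enorm0 : enorm (0 : 'rV[R]_n) = 0.
Proof. by rewrite -(scale0r 0) enormZ // mul0r. Qed.

Lemma enorm_gt0 x : x != 0 -> 0 < enorm x.
Proof.
move=> x0; rewrite /enorm sqrtr_gt0 lt_neqAle sumr_ge0 ?andbT; last first.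
  by move=> i _; exact: sqr_ge0.
rewrite eq_sym; apply: contra x0 => /eqP s0; apply/eqP/rowP => i; rewrite mxE.
apply/eqP; rewrite -sqrf_eq0; apply/eqP.
by apply: (psumr_eq0P _ s0) => // j _; exact: sqr_ge0.
Qed.

Lemma continuous_enorm : continuous (@enorm R n).
Proof.
move=> x; apply: (@continuous_comp _ _ _ (fun y : 'rV[R]_n => \sum_i y 0 i ^+ 2)
  Num.sqrt); last exact: sqrt_continuous.
move: x; apply: continuous_big => [|i _ x]; first exact: add_continuous.
apply: (@continuous_comp _ _ _ (fun y : 'rV[R]_n => y 0 i) (fun a => a ^+ 2)).
  exact: coord_continuous.
exact: exprn_continuous.
Qed.

Lemma continuous_normalize x :
  x != 0 -> {for x, continuous (@normalize R n)}.
Proof.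
move=> x0; have n0 : enorm x != 0 by rewrite gt_eqF // enorm_gt0.
exact: (cvgZ (cvgV n0 (@continuous_enorm x)) (@cvg_id _ (nbhs x))).
Qed.

(** Away from the origin [Omega] is the composite of [normalize], which is continuous there, with a
    Lipschitz function on the sphere. *)
Lemma continuous_homogeneous0 Omega x : homogeneous0 Omega ->
  sphere_lipschitz Omega -> x != 0 -> {for x, continuous Omega}.
Proof.
move=> hom [L lip] x0.
(* The Lipschitz constant comes without a sign, hence the absolute value. *)
pose h v := `|L| * enorm (normalize v - normalize x).
have OmegaE v : v != 0 -> Omega v = Omega (normalize v).
  by move=> v0; rewrite /normalize hom // invr_gt0 enorm_gt0.
have sphereE v : v != 0 -> esphere (normalize v).
  move=> v0; rewrite /esphere /= enormZ ?invr_ge0 ?ltW ?enorm_gt0 //.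
  by rewrite mulVf // gt_eqF // enorm_gt0.
have h0 : h v @[v --> x] --> (0 : R).
  have <- : `|L| * enorm (normalize x - normalize x) = 0.
    by rewrite subrr enorm0 mulr0.
  have hB : normalize v - normalize x @[v --> x] --> normalize x - normalize x.
    exact: (@cvgB _ _ _ (nbhs x) _ _ (cst _) _ _ (continuous_normalize x0)
      (cvg_cst _)).
  have hC := cvg_comp (fun v => normalize v - normalize x) _ hB
    (@continuous_enorm _).
  exact: (@cvgMl_tmp _ _ _ (nbhs_filter x)
    (fun v => enorm (normalize v - normalize x)) `|L| _ hC).
(* Left implicit, the filter gets unfolded and its instance is not found. *)
apply/(@cvgrPdist_le _ _ _ _ (nbhs_filter x)) => e e0; near=> v.
have v0 : v != 0.
  near: v; exact: (@cvgr_neq0 _ _ _ _ (nbhs_filter x) id x _ x0).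
rewrite distrC OmegaE // [X in _ - X]OmegaE //.
apply: le_trans (lip _ _ (sphereE _ v0) (sphereE _ x0)) _.
apply: (@le_trans _ _ (h v)).
  by rewrite ler_wpM2r ?sqrtr_ge0 // ler_norm.
apply: le_trans (ler_norm _) _; near: v.
exact: (@cvgr0_norm_le _ _ _ _ (nbhs_filter x)).
Unshelve. all: by end_near. Qed.

Lemma continuous_czk Omega x : homogeneous0 Omega -> sphere_lipschitz Omega ->
  x != 0 -> {for x, continuous (fun v => Omega v / enorm v ^+ n)}.
Proof.
move=> hom lip x0.
have cX := @cvg_comp _ _ _ _ _ _ _ _ (@continuous_enorm x)
  (@exprn_continuous R n (enorm x)).
have n0 : enorm x ^+ n != 0 by rewrite expf_neq0 // gt_eqF // enorm_gt0.
exact: (@cvgM _ _ _ (nbhs_filter x) _ _ _ _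
  (continuous_homogeneous0 hom lip x0) (@cvgV _ _ _ (nbhs_filter x) _ _ n0 cX)).
Qed.

Lemma czk_scale Omega (s : R) v : homogeneous0 Omega -> 0 < s -> v != 0 ->
  Omega (s *: v) / enorm (s *: v) ^+ n = Omega v / enorm v ^+ n / s ^+ n.
Proof.
by move=> hom s0 v0; rewrite hom // enormZ ?ltW // exprMn invfM mulrCA mulrC.
Qed.

(** Every difference of a point of the translated cube and a point of the original one has the form
    [z]. With s = l N, [z] is s times a small perturbation of [u], where continuity keeps the kernel
    comparable to its value at [u]; homogeneity of degree -n restores the scale. The bound by [c2]
    serves integrability, the one by [delta] keeps [z] away from the singularity. *)
Lemma czk_off_diagonal Omega u : homogeneous0 Omega -> sphere_lipschitz Omega ->
  u != 0 -> Omega u != 0 ->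
  exists N c1 c2 delta : R, [/\ 0 < c1, 0 < delta &
    forall (l : R) w, 0 < l -> (forall i, `|w 0 i| <= l) ->
    let z := (l * N) *: u + w in
    delta * l <= enorm z /\
    c1 / l ^+ n <= Num.sg (Omega u) * (Omega z / enorm z ^+ n) <= c2 / l ^+ n].
Proof.
move=> hom lip u0 Ou0.
pose k v := Num.sg (Omega u) * (Omega v / enorm v ^+ n).
have ck : k v @[v --> u] --> k u.
  exact: (@cvgMl_tmp _ _ _ (nbhs_filter u) _ _ _ (continuous_czk hom lip u0)).
have nu0 := enorm_gt0 u0.
have ku0 : 0 < k u.
  rewrite /k mulrA -normrEsg divr_gt0 ?normr_gt0 //.
  by rewrite exprn_gt0.
have kge : \forall v \near u, k u / 2 < k v.
  apply: (@cvgr_gt _ _ _ (nbhs_filter u) _ _ ck); lra.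
have kle : \forall v \near u, k v < k u * 2.
  apply: (@cvgr_lt _ _ _ (nbhs_filter u) _ _ ck); lra.
have nge : \forall v \near u, enorm u / 2 < enorm v.
  apply: (@cvgr_gt _ _ _ (nbhs_filter u) _ _ (@continuous_enorm u)); lra.
have : \forall v \near u,
    k u / 2 < k v /\ k v < k u * 2 /\ enorm u / 2 < enorm v.
  by apply: filterI => //; exact: filterI.
move=> /nbhs_ballP[e /= e0 ue].
have N0 : 0 < 2 / e by rewrite divr_gt0.
(* With N = 2/e, the perturbation w/s has coordinates at most e/2, inside the ball of radius [e]
   found above. The powers of N in the other witnesses turn s^n into l^n. *)
exists (2 / e), (k u / 2 / (2 / e) ^+ n), (k u * 2 / (2 / e) ^+ n),
  (enorm u / 2 * (2 / e)).
split => //.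
- by rewrite !divr_gt0 // exprn_gt0.
- by rewrite mulr_gt0 // divr_gt0.
move=> l w l0 wl; set s := l * (2 / e); set z := s *: u + w.
have s0 : 0 < s by rewrite mulr_gt0.
pose v := u + s^-1 *: w.
have zE : z = s *: v.
  by rewrite /z /v scalerDr scalerA mulfV ?gt_eqF // scale1r.
have [kv1 [kv2 nv]] : k u / 2 < k v /\ k v < k u * 2 /\ enorm u / 2 < enorm v.
  apply: ue; split => // i j; rewrite ord1 /v !mxE /ball /= opprD addNKr normrN.
  rewrite normrM ger0_norm ?invr_ge0 ?ltW // mulrC ltr_pdivrMr //.
  apply: le_lt_trans (wl j) _.
  have -> : e * s = 2 * l by rewrite /s; field; rewrite gt_eqF.
  by lra.
have v0 : v != 0.
  by apply/eqP => v0; move: nv; rewrite v0 enorm0; lra.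
rewrite zE czk_scale // enormZ ?(ltW s0) // (mulrA (Num.sg _)) -/(k v); split.
  have -> : enorm u / 2 * (2 / e) * l = s * (enorm u / 2) by rewrite /s; ring.
  by rewrite ler_pM2l // ltW.
have cE (c : R) : c / (2 / e) ^+ n / l ^+ n = c / s ^+ n.
  by rewrite /s [(l * _) ^+ n]exprMn [in RHS]invfM mulrA mulrAC.
rewrite (cE (k u / 2)) (cE (k u * 2)); apply/andP.
by split; rewrite ler_pM2r ?invr_gt0 ?exprn_gt0 // ltW.
Qed.

End enorm.

(** * Medians *)

Lemma measure_bigcap_ge d (T : measurableType d) (R : realType)
    (mu : {measure set T -> \bar R}) (F : (set T)^nat) (c : \bar R) :
  (mu (F 0%N) < +oo)%E -> (forall k, measurable (F k)) ->
  nonincreasing_seq F -> (forall k, (c <= mu (F k))%E) ->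
  (c <= mu (\bigcap_k F k))%E.
Proof.
move=> F0 mF niF cF.
have cv := nonincreasing_cvg_mu F0 mF (bigcapT_measurable mF) niF.
rewrite -(cvg_lim _ cv) //; apply: lime_ge.
  by apply/cvg_ex; eexists; exact: cv.
by apply: nearW => k; exact: cF.
Qed.

Lemma ler_addSinv (R : realType) (x y : R) :
  (forall k : nat, x <= y + k.+1%:R^-1) -> x <= y.
Proof.
move=> xy; apply/ler_addgt0Pr => e e0.
have [k _ /(_ k (leqnn k)) /= ke] := near_infty_natSinv_lt (PosNum e0).
by apply: le_trans (xy k) _; rewrite lerD2l ltW.
Qed.

(** The median is the supremum of the levels s for which b >= s on at least half of [P]. All
    limiting arguments are continuity from above, legitimate because [P] has finite measure. *)
Lemma median_exists d (T : measurableType d) (R : realType)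
    (mu : {measure set T -> \bar R}) (P : set T) (b : T -> R) (p : R) :
  measurable P -> 0 < p -> mu P = p%:E -> measurable_fun P b ->
  exists m : R, ((p / 2)%:E <= mu (P `&` [set x | (m <= b x)%R]))%E /\
                ((p / 2)%:E <= mu (P `&` [set x | (b x <= m)%R]))%E.
Proof.
move=> mP p0 muP mb; set c := (p / 2)%:E.
have mge s : measurable (P `&` [set x | s <= b x]).
  have -> : [set x | s <= b x] = b @^-1` `[s, +oo[%classic.
    by apply/seteqP; split=> x /=; rewrite in_itv /= andbT.
  exact: mb.
have mlt s : measurable (P `&` [set x | b x < s]).
  have -> : [set x | b x < s] = b @^-1` `]-oo, s[%classic.
    by apply/seteqP; split=> x /=; rewrite in_itv.
  exact: mb.
(* A lower bound that holds along a decreasing sequence of sets passes to any measurable superset of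
   the intersection. *)
have capP (F : nat -> set T) (A : set T) :
    (forall k, measurable (P `&` F k)) ->
    {homo F : i j / (i <= j)%N >-> j `<=` i} -> \bigcap_k F k `<=` A ->
    measurable (P `&` A) -> (forall k, (c <= mu (P `&` F k))%E) ->
    (c <= mu (P `&` A))%E.
  move=> mF niF FA mA cF.
  apply: (@le_trans _ _ (mu (\bigcap_k (P `&` F k)))).
    apply: measure_bigcap_ge => //.
      apply: (@le_lt_trans _ _ (mu P)); last by rewrite muP ltry.
      by apply: le_measure; rewrite ?inE.
    by move=> i j ij; apply/subsetPset; apply: setIS; exact: niF.
  apply: le_measure; rewrite ?inE //; first exact: bigcapT_measurable.
  move=> x Fx; split; first by have [] := Fx 0%N Logic.I.
  by apply: FA => k _; have [] := Fx k Logic.I.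
have c0 : (c <= mu (P `&` set0))%E -> False.
  by rewrite setI0 measure0 lee_fin leNgt divr_gt0.
pose S := [set s : R | (c <= mu (P `&` [set x | (s <= b x)%R]))%E].
have Sdown s t : s <= t -> S t -> S s.
  move=> st; rewrite /S /= => /le_trans; apply.
  apply: le_measure; rewrite ?inE //; apply: setIS => x /=.
  exact: le_trans.
(* Otherwise both {b < s} and {s <= b} would fill less than half of [P]. *)
have SC s : ~ S s -> (c <= mu (P `&` [set x | (b x < s)%R]))%E.
  move=> nS; rewrite leNgt; apply/negP => lts.
  have ltg : (mu (P `&` [set x | (s <= b x)%R]) < c)%E.
    by rewrite ltNge; apply/negP.
  suff : (mu P < c + c)%E by rewrite muP -EFinD -splitr ltxx.
  have -> : P = (P `&` [set x | b x < s]) `|` (P `&` [set x | s <= b x]).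
    rewrite -setIUr (_ : _ `|` _ = setT) ?setIT //.
    by apply/seteqP; split=> x //= _; case: (ltP (b x) s); [left|right].
  rewrite measureU //; first exact: lteD.
  apply/seteqP; split=> x //= [[_ +] [_ +]] => /lt_le_trans /[apply].
  by rewrite ltxx.
(* If [S] were empty, the sets {b < -k} would all fill half of [P] while decreasing to the empty
   set. Boundedness of [S] follows in the same way from the sets {k <= b}. *)
have [s0 Ss0] : exists s, S s.
  apply: contrapT => /forallNP nS; apply: c0.
  apply: (capP (fun k => [set x | b x < - k%:R])) => //.
  - by move=> i j ij x /= /lt_le_trans; apply; rewrite lerN2 ler_nat.
  - move=> x /= /(_ (Num.bound (b x)) Logic.I) /=.
    by apply/negP; rewrite -leNgt lerNl ltW // unstable.ltrNbound.
  - by rewrite setI0.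
  - by move=> k; exact: SC.
have [t0 St0] : exists t, ubound S t.
  suff [k nSk] : exists k : nat, ~ S k%:R.
    exists k%:R => s Ss; rewrite leNgt; apply/negP => ks.
    by apply: nSk; exact: Sdown (ltW ks) Ss.
  apply/existsNP => SS; apply: c0.
  apply: (capP (fun k => [set x | k%:R <= b x])) => //.
  - by move=> i j ij x /=; apply: le_trans; rewrite ler_nat.
  - move=> x /= /(_ (Num.bound (b x)) Logic.I) /=.
    by apply/negP; rewrite -ltNge unstable.ltr_bound.
  - by rewrite setI0.
have supS : has_sup S by split; [exists s0|exists t0].
(* The level sup S - 1/(k+1) lies below a member of [S], so it is in [S]; sup S + 1/(k+1) is not in
   [S], so [SC] applies to it. Then k tends to infinity. *)
exists (sup S); split.
- apply: (capP (fun k => [set x | sup S - k.+1%:R^-1 <= b x])) => //.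
  + move=> i j ij x /=; apply: le_trans.
    by rewrite lerD2l lerN2 lef_pV2 ?posrE // ler_nat.
  + by move=> x /= h; apply: ler_addSinv => k; rewrite -lerBlDr; exact: h.
  + move=> k.
    have [|s Ss ls] := @sup_adherent _ S k.+1%:R^-1 _ supS.
      by rewrite invr_gt0.
    exact: Sdown (ltW ls) Ss.
- apply: (capP (fun k => [set x | b x < sup S + k.+1%:R^-1])) => //.
  + move=> i j ij x /= /lt_le_trans; apply.
    by rewrite lerD2l lef_pV2 ?posrE // ler_nat.
  + by move=> x /= h; apply: ler_addSinv => k; apply: ltW; exact: h.
  + have -> : [set x | b x <= sup S] = b @^-1` `]-oo, sup S]%classic.
      by apply/seteqP; split=> x /=; rewrite in_itv.
    exact: mb.
  + move=> k; apply: SC => Sk; have := ub_le_sup supS.2 Sk.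
    by rewrite leNgt ltrDl invr_gt0 ltr0Sn.
Qed.

(** * Principal values and commutators at positive distance from the support *)

Lemma measurable_off_ball (R : realType) (n : nat) (x : 'rV[R]_n) (e : R) :
  measurable (off_ball x e).
Proof.
apply: measurable_lebesgue_space.
have mf : measurable_fun setT (fun y : 'rV[R]_n => enorm (x - y)).
  apply: (measurableT_comp (@measurable_enorm R n)).
  apply/measurable_fun_rowP => i; under eq_fun do rewrite mxE.
  apply: measurable_funD; first exact: measurable_cst.
  under eq_fun do rewrite mxE.
  by apply: measurable_funN; exact: (@measurable_row_coor R n i).
have := mf measurableT `]e, +oo[%classic (measurable_itv _).
rewrite setTI; congr measurable.
by apply/seteqP; split=> y /=; rewrite /off_ball /= in_itv /= andbT.
Qed.

(** For e < [delta] the truncation removes nothing from [E], so the truncated integrals are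
    eventually constant as e tends to 0. *)
Lemma pv_off_support (R : realType) (n : nat) (k : 'rV[R]_n -> 'rV[R]_n -> R)
    (f : 'rV[R]_n -> R) (E : set (lebesgue_space R n)) (x : 'rV[R]_n)
    (delta : R) :
  measurable E -> 0 < delta -> (forall y, E y -> delta <= enorm (x - y)) ->
  (forall y, ~ E y -> f y = 0) ->
  lebesgue.-integrable E (fun y => (k x y * f y)%:E) ->
  pv_defined k f x /\ pv k f x = \int[lebesgue]_(y in E) (k x y * f y).
Proof.
move=> mE d0 dE f0 iE; pose g (y : lebesgue_space R n) := k x y * f y.
have gE : g = g \_ E.
  apply/funext => y; rewrite patchE; case: ifPn => // /negP yE.
  by rewrite /g f0 ?mulr0 // => Ey; apply: yE; rewrite inE.
have ig : lebesgue.-integrable setT (EFin \o g).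
  by rewrite gE -restrict_EFin; apply: (integrable_mkcond _ mE).1; exact: iE.
have near_eq : \forall e \near (0:R)^'+,
    truncated k f x e = \int[lebesgue]_(y in E) (k x y * f y).
  near=> e.
  rewrite /truncated -/g.
  transitivity (\int[lebesgue]_(y in off_ball x e) (g \_ E) y).
    by apply: eq_Rintegral => y _; rewrite -gE.
  rewrite -Rintegral_mkcondr; congr Rintegral; apply/seteqP.
  split=> [y []//|y Ey]; split => //.
  apply: lt_le_trans (dE _ Ey); near: e; exact: nbhs_right_lt.
have cv : truncated k f x e @[e --> 0^'+] -->
    \int[lebesgue]_(y in E) (k x y * f y).
  exact: cvg_near_cst.
split; last by rewrite /pv; exact: cvg_lim cv.
split=> [e e0|]; last by apply/cvg_ex; eexists; exact: cv.
apply: integrableS (ig) => //; exact: measurable_off_ball.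
Unshelve. all: by end_near. Qed.

(** Both principal values are then ordinary integrals and merge into one. That the commutator is
    defined has to be proved too, since [weak_estimate] only counts such points. *)
Lemma commutator_off_support (R : realType) (n : nat) (b : 'rV[R]_n -> R)
    (k : 'rV[R]_n -> 'rV[R]_n -> R)
    (E : set (lebesgue_space R n)) (x : 'rV[R]_n) (delta : R) :
  measurable E -> 0 < delta -> (forall y, E y -> delta <= enorm (x - y)) ->
  lebesgue.-integrable E (fun y => (k x y)%:E) ->
  lebesgue.-integrable E (fun y => (k x y * b y)%:E) ->
  commutator_defined b k \1_E x /\
  commutator b k \1_E x = \int[lebesgue]_(y in E) (k x y * (b y - b x)).
Proof.
move=> mE d0 dE ik ikb.
have E1 y : y \in E -> \1_E y = 1 :> R by move=> yE; rewrite indicE yE.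
have E0 y : ~ E y -> \1_E y = 0 :> R by move=> yE; rewrite indicE memNset.
have ik1 : lebesgue.-integrable E (fun y => (k x y * \1_E y)%:E).
  by apply: eq_integrable ik => // y yE; rewrite E1 // mulr1.
have ikb1 : lebesgue.-integrable E (fun y => (k x y * (b \* \1_E) y)%:E).
  by apply: eq_integrable ikb => // y yE; rewrite /= E1 // mulr1.
have [def1 pv1] := pv_off_support mE d0 dE E0 ik1.
have [|def2 pv2] := pv_off_support mE d0 dE _ ikb1.
  by move=> y yE /=; rewrite E0 // mulr0.
split=> //; rewrite /commutator pv1 pv2 -RintegralZl // -RintegralB //.
  apply: eq_Rintegral => y yE /=; rewrite E1 //; ring.
rewrite (_ : _ \o _ = (fun y => (b x)%:E * (k x y * \1_E y)%:E)%E) //.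
exact: integrableZl.
Qed.

(** * From the weak type estimate to mean oscillation *)

Section oscillation.
Variables (R : realType) (n : nat).
Implicit Types (a x y u w : 'rV[R]_n) (b Omega : 'rV[R]_n -> R).
Implicit Types E F : set (lebesgue_space R n).

Lemma loc_integrable_cube b a (l : R) :
  loc_integrable b -> lebesgue.-integrable (cube a l) (EFin \o b).
Proof.
move=> [mb ib]; apply/integrableP; split.
  by apply/measurable_EFinP; apply: measurable_funTS; exact: mb.
exact: (ib _ (@compact_cube R n a l)).
Qed.

Lemma bounded_cube a (l : R) E :
  E `<=` cube a l -> bounded_set (E : set 'rV[R]_n).
Proof.
move=> EQ; have := compact_bounded (@compact_cube R n a l).
by apply: sub_boundedr => A QA y Ey; apply: QA; exact: EQ.
Qed.

(** The kernel is continuous in y on the open set where y differs from [x], and this set contains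
    [E]. *)
Lemma measurable_czk Omega x E : homogeneous0 Omega -> sphere_lipschitz Omega ->
  ~ E x -> measurable E ->
  measurable_fun E (fun y : lebesgue_space R n => czk Omega x y).
Proof.
move=> hom lip Ex mE.
pose U : set 'rV[R]_n := [set y | y != x].
have oU : open U.
  rewrite openE => y yx; rewrite /interior.
  have : \forall z \near y, z - x != 0.
    apply: (@cvgr_neq0 _ _ _ _ (nbhs_filter y) (fun z => z - x) (y - x)).
      exact: (@cvgB _ _ _ (nbhs y) _ _ (cst _) _ _ cvg_id (cvg_cst _)).
    by rewrite subr_eq0.
  by apply: filterS => z; rewrite subr_eq0.
have mU :
    measurable_fun (U : set (lebesgue_space R n)) (fun y => czk Omega x y).
  apply: measurable_fun_lebesgue_space; first exact: measurable_open_row.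
  apply: measurable_fun_open_row => // y yx.
  apply: (@continuous_comp _ _ _ (fun y : 'rV[R]_n => x - y)
    (fun v => Omega v / enorm v ^+ n)).
    exact: (@cvgB _ _ _ (nbhs y) _ (cst x) id _ _ (cvg_cst _) cvg_id).
  by apply: continuous_czk => //; rewrite subr_eq0 eq_sym.
apply: measurable_funS mU.
  by apply: measurable_lebesgue_space; exact: measurable_open_row.
by move=> y Ey; apply/eqP => yx; apply: Ex; rewrite -yx.
Qed.

(** For small arguments the logarithm contributes nothing, so the L log L estimate becomes a linear
    one. *)
Lemma phi1_lt (t : R) : 0 <= t -> t < 1 / 2 -> phi1 t = t.
Proof.
move=> t0 t1; rewrite /phi1 max_r ?addr0 ?mulr1 //.
by apply: ln_le0; lra.
Qed.

(** If A > 2B, some level t has 2B < t < A. Then [F] lies in the superlevel set, whence v/2 <= |F|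
    <= (B/t)|E| <= (B/t) v < v/2, a contradiction. *)
Lemma weak_estimate_le b (k : 'rV[R]_n -> 'rV[R]_n -> R) (B A v : R) E F :
  0 <= B -> weak_estimate b k B -> test_set b k E -> 0 < v ->
  (lebesgue E <= v%:E)%E -> ((v / 2)%:E <= lebesgue F)%E ->
  (forall x, F x -> commutator_defined b k \1_E x /\
    A <= `|commutator b k \1_E x|) -> A <= 2 * B.
Proof.
move=> B0 wB tE v0 Ev vF FA; rewrite leNgt; apply/negP => AB.
have [mE _] := tE.
pose t := (A + 2 * B) / 2.
have t0 : 0 < t by rewrite /t; lra.
have tA : t < A by rewrite /t; lra.
have Bt0 : 0 <= B / t by rewrite divr_ge0 // ltW.
have Bt : B / t < 1 / 2 by rewrite ltr_pdivrMr // /t; lra.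
suff : ((v / 2)%:E <= (B / t * v)%:E)%E by rewrite lee_fin; nra.
apply: (le_trans vF); apply: (@le_trans _ _ ((B / t)%:E * lebesgue E)%E).
  apply: le_trans (_ : _ <= \int[lebesgue]_x (phi1 (B * \1_E x / t)%R)%:E)%E _.
    apply: le_trans (wB E tE t t0); apply: le_lebesgue => x /FA[dx Ax].
    by split=> //; exact: lt_le_trans Ax.
  (* On [E] the argument B/t is below 1/2, so [phi1] is the identity there; off [E] its value is
     0. *)
  rewrite (_ : (fun x => _) = (fun x => (B / t)%:E * (\1_E x)%:E)%E); last first.
    apply/funext => x; rewrite -EFinM; congr EFin.
    rewrite indicE; case: (x \in E); rewrite ?mulr1 ?mulr0 ?mul0r.
      exact: phi1_lt.
    by rewrite /phi1 mul0r.
  rewrite ge0_integralZl_EFin //; last exact/measurable_EFinP/measurable_indic.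
  by rewrite integral_indic // setIT.
by rewrite (EFinM (B / t)) lee_wpmul2l // lee_fin.
Qed.

(* The sign [tau] is 1 for the part b <= m of the cube and -1 for the other. *)
Lemma half_oscillation_le Omega u (N c1 c2 delta : R) b (B : R) a (l m tau : R)
    E F :
  homogeneous0 Omega -> sphere_lipschitz Omega -> Omega u != 0 ->
  0 < c1 -> 0 < delta ->
  (forall (l : R) w, 0 < l -> (forall i, `|w 0 i| <= l) ->
    let z := (l * N) *: u + w in
    delta * l <= enorm z /\
    c1 / l ^+ n <= Num.sg (Omega u) * (Omega z / enorm z ^+ n) <= c2 / l ^+ n) ->
  loc_integrable b -> 0 <= B -> weak_estimate b (czk Omega) B ->
  0 < l -> `|tau| = 1 ->
  measurable E -> E `<=` cube a l ->
  F `<=` cube (a + (l * N) *: u) l -> ((l ^+ n / 2)%:E <= lebesgue F)%E ->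
  (forall y, E y -> 0 <= tau * (m - b y)) ->
  (forall x, F x -> 0 <= tau * (b x - m)) ->
  c1 / l ^+ n * (\int[lebesgue]_(y in E) `|b y - m|) <= 2 * B.
Proof.
move=> hom lip Ou0 c10 d0 H lb B0 wB l0 tau1 mE EQ FP Fl Em Fm.
have ln0 : 0 < l ^+ n by rewrite exprn_gt0.
pose sigma := Num.sg (Omega u).
have sigma1 : `|sigma| = 1 by rewrite normr_sg Ou0.
(* Relative to the corners of their cubes, both points have coordinates in [0, l], so the remainder
   w has coordinates at most l in absolute value. *)
have kb x y : F x -> E y -> delta * l <= enorm (x - y) /\
    c1 / l ^+ n <= sigma * czk Omega x y <= c2 / l ^+ n.
  move=> /FP Px /EQ Qy; pose w := x - y - (l * N) *: u.
  rewrite /czk (_ : x - y = (l * N) *: u + w); last first.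
    by rewrite /w addrCA subrr addr0.
  apply: H => // i; rewrite /w !mxE ler_norml.
  have := Px i; have := Qy i; rewrite !mxE => /andP[y1 y2] /andP[x1 x2].
  by apply/andP; split; lra.
have lE : (lebesgue E <= (l ^+ n)%:E)%E.
  by rewrite -(lebesgue_cube a (ltW l0)); exact: le_lebesgue.
have ib : lebesgue.-integrable E (EFin \o b).
  apply: integrableS (loc_integrable_cube a l lb) => //.
  exact: measurable_cube.
have icst (c : R) : lebesgue.-integrable E (EFin \o cst c).
  apply: measurable_bounded_integrable => //.
    by apply: le_lt_trans lE _; rewrite ltry.
  exists `|c|; split; first exact: num_real.
  by move=> M cM y _; exact: ltW.
have im : lebesgue.-integrable E (EFin \o (fun y => `|b y - m|)).
  exact: (integrable_norm (integrableB mE ib (icst m))).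
apply: (weak_estimate_le B0 wB _ ln0 lE Fl).
  by split => //; left; exact: bounded_cube EQ.
move=> x Fx.
have Ex : ~ E x.
  move=> Ex; have [+ _] := kb x x Fx Ex.
  by rewrite subrr enorm0 leNgt mulr_gt0.
have mk := measurable_czk hom lip Ex mE.
(* Since sigma has modulus 1 and sigma times the kernel is positive, the upper bound controls the
   modulus of the kernel. Its product with [b] is then integrable on [E]. *)
have bk : [bounded czk Omega x y : R^o | y in E].
  exists (c2 / l ^+ n); split; first exact: num_real.
  move=> M cM y Ey; have [_ /andP[k1 k2]] := kb x y Fx Ey.
  have c10' : 0 < c1 / l ^+ n by rewrite divr_gt0.
  change (`|czk Omega x y| <= M).
  rewrite -[`|_|]mul1r -sigma1 -normrM ger0_norm.
    exact: le_trans k2 (ltW cM).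
  exact: le_trans (ltW c10') k1.
have ik : lebesgue.-integrable E (fun y => (czk Omega x y)%:E).
  apply: measurable_bounded_integrable => //.
  by apply: le_lt_trans lE _; rewrite ltry.
have ikb : lebesgue.-integrable E (fun y => (czk Omega x y * b y)%:E).
  exact: (integrableMr mE mk bk ib).
have [||cdef ->] := @commutator_off_support _ _ b (czk Omega) E x (delta * l)
  mE _ _ ik ikb.
- by rewrite mulr_gt0.
- by move=> y Ey; have [] := kb x y Fx Ey.
split=> //.
have ic : lebesgue.-integrable E
    (EFin \o (fun y => czk Omega x y * (b y - b x))).
  exact: (integrableMr mE mk bk (integrableB mE ib (icst (b x)))).
rewrite -RintegralZl //.
(* The factor -(sigma tau) has modulus 1 and makes the integrand nonnegative. *)
have -> : `|\int[lebesgue]_(y in E) (czk Omega x y * (b y - b x))| =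
    `|\int[lebesgue]_(y in E)
        (- (sigma * tau) * (czk Omega x y * (b y - b x)))|.
  by rewrite RintegralZl // normrM normrN normrM sigma1 tau1 !mul1r.
apply: le_trans (ler_norm _).
apply: le_Rintegral => //.
- exact: (integrableZl mE _ im).
- exact: (integrableZl mE _ ic).
move=> y Ey; have [_ /andP[k1 _]] := kb x y Fx Ey.
have -> : `|b y - m| = tau * (m - b y).
  by rewrite -(ger0_norm (Em y Ey)) normrM tau1 mul1r distrC.
have := Em y Ey; have := Fm x Fx.
have : 0 < c1 / l ^+ n by rewrite divr_gt0.
move: k1; set c := c1 / _; set s := sigma * _ => cs c0 hx hy.
(* Splitting b y - b x at the median gives two terms of the same sign; the one with b x is dropped
   and s is bounded below by c. *)
have -> : - (sigma * tau) * (czk Omega x y * (b y - b x)) =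
    s * (tau * (m - b y)) + s * (tau * (b x - m)) by rewrite /s; ring.
apply: (@le_trans _ _ (s * (tau * (m - b y)))); first exact: ler_wpM2r.
by rewrite lerDl mulr_ge0 // (le_trans (ltW c0)).
Qed.

Lemma integrable_cube_cst a (l c : R) :
  0 <= l -> lebesgue.-integrable (cube a l) (EFin \o cst c).
Proof.
move=> l0; apply: measurable_bounded_integrable.
- exact: measurable_cube.
- have lQ : (lebesgue (cube a l) <= (l ^+ n)%:E)%E by rewrite lebesgue_cube.
  by apply: le_lt_trans lQ _; rewrite ltry.
- exact: measurable_cst.
exists `|c|; split; first exact: num_real.
by move=> M cM y _; exact: ltW.
Qed.

(** The mean may be replaced by any constant m at the cost of a factor 2, because |m - b_Q| is at
    most the average of |b - m| over the cube. *)
Lemma mean_osc_le b a (l m : R) : loc_integrable b -> 0 < l ->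
  (mean_osc b (cube a l) <=
   (2 * ((l ^+ n)^-1 * \int[lebesgue]_(y in cube a l) `|b y - m|))%:E)%E.
Proof.
move=> lb l0; set Q := cube a l.
have mQ : measurable Q by exact: measurable_cube.
have ln0 : 0 < l ^+ n by rewrite exprn_gt0.
have ib : lebesgue.-integrable Q (EFin \o b) by exact: loc_integrable_cube.
have icst c : lebesgue.-integrable Q (EFin \o cst c).
  by apply: integrable_cube_cst; exact: ltW.
have ibc c : lebesgue.-integrable Q (EFin \o (fun y => b y - c)).
  exact: (integrableB mQ ib (icst c)).
have inc c : lebesgue.-integrable Q (EFin \o (fun y => `|b y - c|)).
  exact: (integrable_norm (ibc c)).
have lQ : fine (lebesgue Q) = l ^+ n by rewrite lebesgue_cube // ltW.
rewrite /mean_osc lQ.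
rewrite -(fineK (integrable_fin_num mQ (inc (mean b Q)))) -EFinM lee_fin.
rewrite -/(Rintegral lebesgue Q (fun y => `|b y - mean b Q|)).
rewrite mulrCA ler_pM2l ?invr_gt0 //.
set I := \int[lebesgue]_(y in Q) `|b y - m|.
have mI : l ^+ n * `|m - mean b Q| <= I.
  rewrite distrC -[X in X * _](gtr0_norm ln0) -normrM mulrBr /mean lQ.
  rewrite mulVKf ?gt_eqF //.
  have -> : l ^+ n * m = \int[lebesgue]_(y in Q) m.
    by rewrite Rintegral_cst // lQ mulrC.
  rewrite -RintegralB //; last exact: icst.
  exact: le_normr_Rintegral.
apply: (@le_trans _ _ (\int[lebesgue]_(y in Q) (`|b y - m| + `|m - mean b Q|))).
  apply: le_Rintegral => //; first exact: integrableD (inc m) (icst _).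
  by move=> y _; exact: ler_distD.
rewrite (RintegralD mQ (inc m) (icst _)) -/I Rintegral_cst // lQ.
by rewrite (mulrC `|_|); move: mI; lra.
Qed.

(** Otherwise the zero set would contain the cube with all coordinates in [1, 2], which has measure
    1 and, as n >= 1, misses the origin. *)
Lemma exists_homogeneous_neq0 Omega : (1 <= n)%N ->
  lebesgue [set x | x != 0 /\ Omega x = 0] = 0%E ->
  exists u, u != 0 /\ Omega u != 0.
Proof.
move=> n1 O0; apply: contrapT => /forallNP nO.
have : (lebesgue (cube (const_mx 1%R : 'rV[R]_n) 1%R) <= 0)%E.
  rewrite -O0; apply: le_lebesgue => x xQ.
  have x0 : x != 0.
    apply/eqP => x0; have := xQ (Ordinal n1); rewrite x0 !mxE => /andP[].
    by rewrite leNgt ltr01.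
  by split=> //; apply/eqP/negPn/negP => Ox; exact: (nO x).
by rewrite lebesgue_cube // expr1n lee_fin leNgt ltr01.
Qed.

End oscillation.

(** * The bound on the BMO norm *)

Theorem theorem3p7 (R : realType) (n : nat) (hn : (1 <= n)%N)
    (Omega : 'rV[R]_n -> R)
    (Omega_hom : homogeneous0 Omega)
    (Omega_lip : sphere_lipschitz Omega)
    (Omega_mean0 :
      (\int[surface_measure]_(th in @esphere R n) (Omega th)%:E = 0)%E)
    (Omega_neq0 :
      lebesgue [set x : 'rV[R]_n | x != 0 /\ Omega x = 0] = 0%E) :
  exists C : R, forall (b : 'rV[R]_n -> R), loc_integrable b ->
    forall B : R, 0 <= B ->
      weak_estimate b (czk Omega) B ->
      weak_estimate b (czk_adj Omega) B ->
      BMO b /\ (bmo_norm b <= (C * B)%:E)%E.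
Proof.
have [u [u0 Ou0]] := exists_homogeneous_neq0 hn Omega_neq0.
have [N [c1 [c2 [delta [c10 d0 H]]]]] :=
  czk_off_diagonal Omega_hom Omega_lip u0 Ou0.
(* Each of the two parts of [Q] contributes 2B/c1 to the average of |b - m|, and passing from m to
   the mean doubles the sum. *)
exists (8 / c1) => b lb B B0 wB _.
suff bound : (bmo_norm b <= (8 / c1 * B)%:E)%E.
  by split=> //; split=> //; apply: le_lt_trans bound _; rewrite ltry.
apply: ge_ereal_sup => _ [a [l [l0 ->]]].
have ln0 : 0 < l ^+ n by rewrite exprn_gt0.
set Q := cube a l; set P := cube (a + (l * N) *: u) l.
have mQ : measurable Q by exact: measurable_cube.
have mP : measurable P by exact: measurable_cube.
have mbT (D : set (lebesgue_space R n)) : measurable_fun D b.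
  by apply: measurable_funTS; exact: lb.1.
have [m [mge mle]] := median_exists mP ln0 (lebesgue_cube _ (ltW l0)) (mbT P).
apply: le_trans (mean_osc_le a m lb l0) _; rewrite lee_fin -/Q.
pose E1 := Q `&` [set y | b y <= m]; pose E2 := Q `&` [set y | m < b y].
have mE1 : measurable E1.
  rewrite (_ : E1 = Q `&` b @^-1` `]-oo, m]%classic); first exact: mbT.
  by apply/seteqP; split=> y /=; rewrite in_itv.
(* The inequality in [E2] is strict so that [E1] and [E2] partition [Q]. *)
have mE2 : measurable E2.
  rewrite (_ : E2 = Q `&` b @^-1` `]m, +oo[%classic); first exact: mbT.
  by apply/seteqP; split=> y /=; rewrite in_itv /= andbT.
have QE : Q = E1 `|` E2.
  rewrite -setIUr (_ : _ `|` _ = setT) ?setIT //.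
  by apply/seteqP; split=> x //= _; case: (leP (b x) m); [left|right].
have e1 : c1 / l ^+ n * (\int[lebesgue]_(y in E1) `|b y - m|) <= 2 * B.
  apply: (half_oscillation_le Omega_hom Omega_lip Ou0 c10 d0 H lb B0 wB l0
    (tau := 1) _ mE1 _ _ mge) => //.
  - by rewrite normr1.
  - exact: subIsetl.
  - exact: subIsetl.
  - by move=> y [_ /=]; rewrite mul1r subr_ge0.
  - by move=> x [_ /=]; rewrite mul1r subr_ge0.
(* The part of [Q] above m is paired with the part of [P] where b <= m, which reverses both signs:
   hence tau = -1. *)
have e2 : c1 / l ^+ n * (\int[lebesgue]_(y in E2) `|b y - m|) <= 2 * B.
  apply: (half_oscillation_le Omega_hom Omega_lip Ou0 c10 d0 H lb B0 wB l0
    (tau := -1) _ mE2 _ _ mle) => //.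
  - by rewrite normrN1.
  - exact: subIsetl.
  - exact: subIsetl.
  - by move=> y [_ /= /ltW]; rewrite mulN1r opprB subr_ge0.
  - by move=> x [_ /=]; rewrite mulN1r opprB subr_ge0.
have ibm : lebesgue.-integrable Q (EFin \o (fun y => `|b y - m|)).
  exact: (integrable_norm (integrableB mQ (loc_integrable_cube a l lb)
    (integrable_cube_cst a m (ltW l0)))).
rewrite [in X in X <= _]QE Rintegral_setU -?QE //; last first.
  apply/disj_setPS => y [[_ /= h1] [_ /= h2]].
  by have := le_lt_trans h1 h2; rewrite ltxx.
move: e1 e2; set I1 := Rintegral _ E1 _; set I2 := Rintegral _ E2 _ => e1 e2.
rewrite mulrAC ler_pdivlMr //.
have -> : 2 * ((l ^+ n)^-1 * (I1 + I2)) * c1 =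
  2 * (c1 / l ^+ n * I1 + c1 / l ^+ n * I2) by ring.
by move: (lerD e1 e2); lra.
Qed.
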